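(* Let $h:\mathbb{R}^n\to\mathbb{R}$ be twice differentiable and strongly convex with symmetric Bregman divergence, i.e. $\mathcal{D}_h(x,y)=\mathcal{D}_h(y,x)$ for all $x,y$. Let $f:\mathbb{R}^n\to\mathbb{R}$ be differentiable, convex and $\sigma$-uniformly convex with respect to $h$ for some $\sigma\ge0$, and let $x^*$ be a minimizer of $f$. Let $\alpha,\delta,\eta,\nu,\pi$ be differentiable functions on $[t_0,T]$, put $A(t)=\dot\delta(t)+\dot\eta(t)-\dot\alpha(t)-e^{\alpha(t)}$, and suppose that for all $t\in[t_0,T]$ $$\begin{cases}\dot\nu(t)\le e^{\alpha(t)},\\ -A(t)+[\dot\nu(t)+\dot\eta(t)]+e^{\pi(t)+\alpha(t)}\le0,\\ A(t)-\sigma e^{-\eta(t)+\alpha(t)}-e^{\pi(t)+\alpha(t)}+[\dot\nu(t)+\dot\eta(t)+\dot\pi(t)]e^{\pi(t)}\le0,\\ -A(t)-e^{\pi(t)+\alpha(t)}\le0.\end{cases}$$ Let $(x(t),z(t))$ be a solution on $[t_0,T]$ of the state equation $$\begin{cases}\dot x(t)=e^{\alpha(t)}(z(t)-x(t)),\\ \nabla^2h(z(t))\,\dot z(t)=-A(t)\bigl[\nabla h(z(t))-\nabla h(x(t))\bigr]-e^{-\eta(t)+\alpha(t)}\nabla f(x(t)).\end{cases}$$ Then the function $$V(t)=e^{\nu(t)}\Bigl(e^{\eta(t)}\bigl[\mathcal{D}_h(x^*,z(t))+e^{\pi(t)}\mathcal{D}_h(x(t),x^* )\bigr]+[f(x(t))-f(x^*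 )]\Bigr)$$ is nonincreasing on $[t_0,T]$; that is, $\dot V(t)\le0$ for all $t\in[t_0,T]$.
   Context: The Bregman divergence of a differentiable convex function $h$ is $\mathcal{D}_h(y,x)=h(y)-h(x)-\nabla h(x)^\top(y-x)$. A differentiable $f$ is $\sigma$-uniformly convex with respect to $h$ ($\sigma\ge0$) if $\mathcal{D}_f(y,x)\ge\sigma\mathcal{D}_h(y,x)$ for all $x,y$. A dot denotes $d/dt$. Note that $z(t)=x(t)+e^{-\alpha(t)}\dot x(t)$ by the first state equation. *)

(* Defs.v *)
From HB Require Import structures.
From mathcomp Require Import all_boot all_order all_algebra.
From mathcomp Require Import all_classical all_reals all_analysis.

Set Implicit Arguments.
Unset Strict Implicit.
Unset Printing Implicit Defensive.

Import Order.TTheory GRing.Theory Num.Theory.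
Import numFieldNormedType.Exports.

Local Open Scope classical_set_scope.
Local Open Scope ring_scope.

(* Points of R^n are row vectors, as required by the library's Jacobian.     *)

Section Derivative_relative_to_a_set.
Context {R : realType} {V : normedModType R}.
Implicit Types (D : set R) (f : R -> V) (t : R).

Definition quotient_on D f t : set_system V :=
  (fun s => (s - t)^-1 *: (f s - f t)) @ within D t^'.

(* Only the values of f on D matter: for D = `[a, b] with a < b, these are   *)
(* the two-sided derivative at interior points and the one-sided derivatives *)
(* at a and b.                                                               *)
Definition derivable_on D f : Prop := forall t, D t -> cvg (quotient_on D f t).

Definition derive_on D f t : V := lim (quotient_on D f t).

End Derivative_relative_to_a_set.

Section Bregman.
Context {R : realType} {n : nat}.
Implicit Types (f h : 'rV[R]_n -> R) (u v x y : 'rV[R]_n).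

Definition dot u v : R := (u *m v^T) 0 0.

Definition grad h x : 'rV[R]_n := \row_i 'D_(delta_mx 0 i) h x.

(* The (i, j) entry is d_i d_j h; in the row-vector convention,              *)
(* v *m hess h x is the (transposed) product of the Hessian with v.          *)
Definition hess h x : 'M[R]_n := 'J (grad h) x.

Definition twice_differentiable h : Prop :=
  (forall x, differentiable h x) /\ (forall x, differentiable (grad h) x).

(* The norm is the Euclidean one, not the library's sup norm on matrices.    *)
Definition strongly_convex h : Prop :=
  exists2 mu : R, 0 < mu & forall x y (t : R), 0 <= t <= 1 ->
    h (t *: x + (1 - t) *: y) <=
      t * h x + (1 - t) * h y - mu / 2 * t * (1 - t) * dot (x - y) (x - y).

Definition bregman h y x : R := h y - h x - dot (grad h x) (y - x).

Definition uniformly_convex_wrt (sigma : R) h f : Prop :=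
  forall x y, sigma * bregman h y x <= bregman f y x.

End Bregman.

(* Main.v *)
(* Along a trajectory, V' is a combination of D(xstar, z), D(x, xstar), D(z, x) and
   f(x) - f(xstar), all nonnegative.  The state equation and the chain rule turn the
   derivatives of the two Bregman terms into pairings of gradient differences with
   differences of points; the three-point identity and the symmetry of D expand these
   into divergences, and the leftover gradient terms add up to the pairing of grad f(x)
   with xstar - x, which uniform convexity bounds.  The four conditions on the
   parameters are exactly the signs of the resulting coefficients. *)
Require Import Defs.
From HB Require Import structures.
From mathcomp Require Import all_boot all_order all_algebra.
From mathcomp Require Import all_classical all_reals all_analysis.
From mathcomp Require Import ring lra.

Set Implicit Arguments.
Unset Strict Implicit.
Unset Printing Implicit Defensive.

Import Order.TTheory GRing.Theory Num.Theory.
Import numFieldNormedType.Exports.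

Local Open Scope classical_set_scope.
Local Open Scope ring_scope.

(** * Differential calculus relative to a subset of the line *)

Section Quotient.
Context {R : realType}.
Implicit Types (D : set R) (t : R).

(** Write [u s] as [u t] plus [s - t] times the quotient: the correction tends to [0 *: d]. *)
Lemma quotient_on_continuous (W : normedModType R) D (u : R -> W) t (d : W) :
  quotient_on D u t --> d -> u @ within D t^' --> u t.
Proof.
move=> ud.
have st : (fun s => s - t) @ within D t^' --> (0 : R).
  rewrite -(subrr t); apply: cvgB; last exact: cvg_cst.
  by move=> P Pt; do 2 apply: cvg_within.
have : (fun s => u t + (s - t) *: ((s - t)^-1 *: (u s - u t))) @ within D t^'
    --> u t + 0 *: d.
  by apply: cvgD; [exact: cvg_cst|exact: cvgZ].
rewrite scale0r addr0; apply: cvg_trans; apply: near_eq_cvg; near=> s => /=.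
have [->|/negPf st0] := eqVneq s t; first by rewrite !subrr scale0r addr0.
by rewrite /= scalerA mulfV ?subr_eq0 ?st0// scale1r addrC subrK.
Unshelve. all: by end_near. Qed.

Lemma quotient_on_eq (W : normedModType R) D (u w : R -> W) t (c d : W) :
  u =1 w -> c = d -> quotient_on D u t --> c -> quotient_on D w t --> d.
Proof. by move=> /funext -> ->. Qed.

Lemma quotient_on_cst (W : normedModType R) D (c : W) t :
  quotient_on D (fun=> c) t --> (0 : W).
Proof.
rewrite /quotient_on (_ : (fun _ => _) = fun=> 0); first exact: cvg_cst.
by apply/funext => s; rewrite subrr scaler0.
Qed.

Lemma quotient_onD (W : normedModType R) D (u w : R -> W) t (du dw : W) :
  quotient_on D u t --> du -> quotient_on D w t --> dw ->
  quotient_on D (fun s => u s + w s) t --> du + dw.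
Proof.
move=> hu hw; rewrite /quotient_on.
rewrite (_ : (fun _ => _) = fun s => (s - t)^-1 *: (u s - u t) + (s - t)^-1 *: (w s - w t)).
  exact: cvgD.
by apply/funext => s; rewrite -scalerDr opprD addrACA.
Qed.

Lemma quotient_onB (W : normedModType R) D (u w : R -> W) t (du dw : W) :
  quotient_on D u t --> du -> quotient_on D w t --> dw ->
  quotient_on D (fun s => u s - w s) t --> du - dw.
Proof.
move=> hu hw; rewrite /quotient_on.
rewrite (_ : (fun _ => _) = fun s => (s - t)^-1 *: (u s - u t) - (s - t)^-1 *: (w s - w t)).
  exact: cvgB.
by apply/funext => s; rewrite -scalerBr !opprD !opprK addrACA.
Qed.

(** Chain rule. By linearity the quotient of [g \o u] is ['d g (u t)] applied to the quotient [q] of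
    [u], plus a remainder [r]. The first term converges by continuity of the differential; [r]
    vanishes because [q] stays bounded. *)
Lemma quotient_on_comp (U W : normedModType R) D (g : U -> W) (u : R -> U) t (d : U) :
  differentiable g (u t) -> quotient_on D u t --> d ->
  quotient_on D (g \o u) t --> 'd g (u t) d.
Proof.
move=> dg ud; have cu := quotient_on_continuous ud.
pose q s := (s - t)^-1 *: (u s - u t).
pose r s := (s - t)^-1 *: (g (u s) - g (u t) - 'd g (u t) (u s - u t)).
rewrite /quotient_on.
rewrite (_ : (fun _ => _) = fun s => 'd g (u t) (q s) + r s); last first.
  by apply/funext => s; rewrite /q /r linearZ -scalerDr; congr (_ *: _); rewrite addrCA subrr addr0.
rewrite -['d g (u t) d]addr0; apply: cvgD.
  by apply: continuous_cvg => //; exact: diff_continuous.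
apply/cvgr0Pnorm_le => e e0.
have qb : \forall s \near within D t^', `|q s| < `|d| + 1.
  by apply: cvgr_norm_lt (ud) _ _; rewrite ltrDl.
(* [K] eventually bounds [q], so the tolerance [e / K] in the first-order expansion of [g] gives a
   remainder of norm at most [e / K * K = e]. *)
set K := `|d| + 1 in qb; have K0 : 0 < K by rewrite /K ltr_wpDl.
have /eqaddoP Ho := diff_locally dg.
have Hg := Ho _ (divr_gt0 e0 K0).
have cu0 : (fun s => u s - u t) @ within D t^' --> (0 : U).
  by rewrite -(subrr (u t)); apply: cvgB => //; exact: cvg_cst.
have := cu0 _ Hg; move=> Hs.
near=> s.
have qs : `|q s| < K by near: s; exact: qb.
have : `|(g \o shift (u t) - (cst (g (u t)) + 'd g (u t))) (u s - u t)|
    <= e / K * `|u s - u t| by near: s; exact: Hs.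
rewrite !fctE /= subrK opprD addrA => Hgs.
rewrite /r normrZ (le_trans (ler_wpM2l (normr_ge0 _) Hgs))//.
rewrite mulrCA -normrZ -mulrA ler_piMr// ?(ltW e0)//.
by rewrite ler_pdivrMl// mulr1 ltW.
Unshelve. all: by end_near. Qed.

Lemma quotient_onM D (u w : R -> R) t (du dw : R) :
  quotient_on D u t --> du -> quotient_on D w t --> dw ->
  quotient_on D (fun s => u s * w s) t --> du * w t + u t * dw.
Proof.
move=> hu hw; have cw := quotient_on_continuous hw; rewrite /quotient_on.
(* The factor [w] is kept at the moving point [s], hence the appeal to its continuity. *)
rewrite (_ : (fun _ => _) =
    fun s => (s - t)^-1 *: (u s - u t) * w s + u t * ((s - t)^-1 *: (w s - w t))).
  by apply: cvgD; apply: cvgM => //; exact: cvg_cst.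
by apply/funext => s; rewrite /GRing.scale/=; ring.
Qed.

Lemma quotient_on_expR D (u : R -> R) t (d : R) :
  quotient_on D u t --> d ->
  quotient_on D (fun s => expR (u s)) t --> d * expR (u t).
Proof.
move=> ud.
have de : differentiable expR (u t) by apply/derivable1_diffP; exact: derivable_expR.
apply: quotient_on_eq (quotient_on_comp de ud) => //.
by rewrite diff1E// derive1E; congr (_ * _); rewrite -[RHS](congr1 (@^~ (u t)) (derive_expR R)).
Qed.

End Quotient.

(** * Euclidean inner product, gradients and Bregman divergences along curves *)

Section Dot.
Context {R : realType} {n : nat}.
Implicit Types u v w x y : 'rV[R]_n.

Lemma dotE u v : dot u v = \sum_i u 0 i * v 0 i.
Proof. by rewrite /dot mxE; apply: eq_bigr => i _; rewrite mxE. Qed.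

Lemma dotDl u v w : dot (u + v) w = dot u w + dot v w.
Proof. by rewrite /dot mulmxDl mxE. Qed.

Lemma dotNl u w : dot (- u) w = - dot u w.
Proof. by rewrite /dot mulNmx mxE. Qed.

Lemma dotZl (a : R) u w : dot (a *: u) w = a * dot u w.
Proof. by rewrite /dot -scalemxAl mxE. Qed.

Lemma dotC u v : dot u v = dot v u.
Proof. by rewrite !dotE; apply: eq_bigr => i _; rewrite mulrC. Qed.

Lemma dotDr u v w : dot w (u + v) = dot w u + dot w v.
Proof. by rewrite dotC dotDl !(dotC _ w). Qed.

Lemma dotNr u w : dot w (- u) = - dot w u.
Proof. by rewrite dotC dotNl dotC. Qed.

Lemma dotZr (a : R) u w : dot w (a *: u) = a * dot w u.
Proof. by rewrite dotC dotZl dotC. Qed.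

Lemma dot_ge0 u : 0 <= dot u u.
Proof. by rewrite dotE sumr_ge0// => i _; rewrite -expr2 sqr_ge0. Qed.

Lemma cvg_dot (F : set_system R) {FF : Filter F} (u v : R -> 'rV[R]_n) (a b : 'rV[R]_n) :
  u @ F --> a -> v @ F --> b -> (fun s => dot (u s) (v s)) @ F --> dot a b.
Proof.
move=> ua vb; rewrite dotE.
rewrite (_ : (fun _ => _) = fun s => \sum_i u s 0 i * v s 0 i); last first.
  by apply/funext => s; rewrite dotE.
apply: cvg_big => [|i _]; first exact: add_continuous.
apply: cvgM.
  exact: cvg_comp ua (@coord_continuous R 1 n 0 i a).
exact: cvg_comp vb (@coord_continuous R 1 n 0 i b).
Qed.

Lemma quotient_on_dot D (u v : R -> 'rV[R]_n) t (du dv : 'rV[R]_n) :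
  quotient_on D u t --> du -> quotient_on D v t --> dv ->
  quotient_on D (fun s => dot (u s) (v s)) t --> dot du (v t) + dot (u t) dv.
Proof.
move=> hu hv; have cv := quotient_on_continuous hv; rewrite /quotient_on.
rewrite (_ : (fun _ => _) = fun s => dot ((s - t)^-1 *: (u s - u t)) (v s)
    + dot (u t) ((s - t)^-1 *: (v s - v t))).
  by apply: cvgD; apply: cvg_dot => //; exact: cvg_cst.
by apply/funext => s; rewrite dotZl dotZr /GRing.scale/= !(dotDl, dotDr, dotNl, dotNr); ring.
Qed.

Lemma dot_grad (h : 'rV[R]_n -> R) x v :
  differentiable h x -> dot (grad h x) v = 'd h x v.
Proof.
move=> hx; rewrite dotE [in RHS](row_sum_delta v) linear_sum.
by apply: eq_bigr => i _; rewrite mxE deriveE// linearZ mulrC.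
Qed.

Lemma quotient_on_grad D (h : 'rV[R]_n -> R) (u : R -> 'rV[R]_n) t (d : 'rV[R]_n) :
  differentiable h (u t) -> quotient_on D u t --> d ->
  quotient_on D (fun s => h (u s)) t --> dot (grad h (u t)) d.
Proof. by move=> dh ud; rewrite dot_grad//; exact: quotient_on_comp. Qed.

(** The values of [h] cancel on the right, leaving only the gradient pairings. *)
Lemma three_point (h : 'rV[R]_n -> R) x y w :
  dot (grad h y - grad h w) (x - y) =
    bregman h x w - bregman h x y - bregman h y w.
Proof. by rewrite /bregman !(dotDl, dotDr, dotNl, dotNr); ring. Qed.

(** For [0 < s <= 1], convexity bounds the difference quotient of [h] at [x] along [y - x] by
    [h y - h x]; letting [s] decrease to 0 bounds the directional derivative. *)
Lemma strongly_convex_bregman_ge0 (h : 'rV[R]_n -> R) x y :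
  (forall x, differentiable h x) -> strongly_convex h -> 0 <= bregman h y x.
Proof.
move=> dh [mu mu0 hc].
rewrite /bregman subr_ge0 dot_grad// -deriveE//.
have dv : (fun s => s^-1 *: (h (s *: (y - x) + x) - h x)) @ 0^'+ --> 'D_(y - x) h x.
  have : (fun s => s^-1 *: (h (s *: (y - x) + x) - h x)) @ 0^' --> 'D_(y - x) h x.
    exact: (@diff_derivable _ _ _ h x (y - x) (dh x)).
  apply: cvg_trans; apply: cvg_app => P; rewrite /dnbhs /at_right !near_simpl.
  rewrite !near_withinE => HP.
  by near=> s => s0; have := near HP s; apply; rewrite ?gt_eqF.
apply: (cvgr_to_le dv); near=> s.
have s0 : 0 < s by [].
have s1 : s <= 1 by near: s; exact: nbhs_right_ltW.
rewrite /GRing.scale/= ler_pdivrMl//.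
have -> : s *: (y - x) + x = s *: y + (1 - s) *: x.
  by rewrite scalerBr scalerBl scale1r addrAC addrA.
rewrite lerBlDr (le_trans (hc _ _ _ _)) ?s1 ?(ltW s0)//.
have : 0 <= mu / 2 * s * (1 - s) * dot (y - x) (y - x).
  by rewrite !mulr_ge0 ?dot_ge0 ?subr_ge0 ?invr_ge0// ltW.
set e := (_ * dot _ _); move: e => e.
lra.
Unshelve. all: by end_near. Qed.

Lemma quotient_on_bregman_l D (h : 'rV[R]_n -> R) (u : R -> 'rV[R]_n) y t
    (d : 'rV[R]_n) :
  differentiable h (u t) -> quotient_on D u t --> d ->
  quotient_on D (fun s => bregman h (u s) y) t -->
    dot (grad h (u t) - grad h y) d.
Proof.
move=> dh ud.
have hd := quotient_onB (quotient_on_grad dh ud) (quotient_on_cst D (h y) t).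
have ld := quotient_on_dot (quotient_on_cst D (grad h y) t)
  (quotient_onB ud (quotient_on_cst D y t)).
apply: quotient_on_eq (quotient_onB hd ld) => //.
by rewrite !subr0 dotDl dotNl -(scale0r (grad h y)) dotZl mul0r add0r.
Qed.

(** The two pairings of [grad h (u t)] with the velocity [d] cancel, so only the Hessian term
    remains; it has the shape of the left side of the state equation. *)
Lemma quotient_on_bregman_r D (h : 'rV[R]_n -> R) y (u : R -> 'rV[R]_n) t
    (d : 'rV[R]_n) :
  differentiable h (u t) -> differentiable (grad h) (u t) ->
  quotient_on D u t --> d ->
  quotient_on D (fun s => bregman h y (u s)) t -->
    - dot (d *m hess h (u t)) (y - u t).
Proof.
move=> dh dgh ud.
have hd := quotient_onB (quotient_on_cst D (h y) t) (quotient_on_grad dh ud).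
have ld := quotient_on_dot (quotient_on_comp dgh ud)
  (quotient_onB (quotient_on_cst D y t) ud).
apply: quotient_on_eq (quotient_onB hd ld) => //.
by rewrite !sub0r dotNr /= -deriveE// deriveEjacobian// /hess; ring.
Qed.

End Dot.

(** * From relative derivatives on a segment to monotonicity *)

Section Interval.
Context {R : realType} (a b : R).

(** Properness makes limits of quotients unique. Points of the segment accumulate at [t] from the
    right if [t < b], and otherwise from the left, since then [a < b <= t]. *)
Lemma within_itv_dnbhs_proper t : a < b -> `[a, b]%classic t ->
  ProperFilter (within `[a, b] t^').
Proof.
move=> ab; rewrite /= in_itv/= => /andP[a_t tb].
split; last exact: within_filter.
move=> t0.
have tI : \forall s \near t, s != t -> `[a, b]%classic s -> False := t0.
have [t_b|b_t] := ltP t b.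
  near t^'+ => s.
  have ts : t < s by [].
  have sb : s <= b by near: s; exact: nbhs_right_ltW.
  have : s != t -> `[a, b]%classic s -> False by near: s; exact: cvg_within tI.
  by apply; rewrite ?gt_eqF//= in_itv/= sb (le_trans a_t (ltW ts)).
near t^'- => s.
have st : s < t by [].
have a_s : a <= s.
  by near: s; apply: nbhs_left_ge; rewrite (lt_le_trans ab).
have : s != t -> `[a, b]%classic s -> False by near: s; exact: cvg_within tI.
by apply; rewrite ?lt_eqF//= in_itv/= a_s (le_trans (ltW st) tb).
Unshelve. all: by end_near. Qed.

(** A neighbourhood of an interior point lies in the segment, so the restriction disappears; the
    rest is the substitution [s = h + t]. *)
Lemma quotient_on_itv_is_derive (V : R -> R) t d : t \in `]a, b[ ->
  quotient_on `[a, b] V t --> (d : R) -> is_derive t 1 V d.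
Proof.
move=> tab Vd.
suff cV : (fun h => h^-1 *: (V (h *: 1 + t) - V t)) @ 0^' --> d.
  split; first by apply/cvg_ex; exists d.
  exact: cvg_lim cV.
have th : (fun h : R => h *: 1 + t) @ 0^' --> within `[a, b] t^'.
  move=> P Pt.
  have : \forall s \near t, s != t -> P s.
    near=> s => st.
    have : s \in `]a, b[ by near: s; exact: near_in_itvoo.
    move=> /subset_itv_oo_cc sI.
    by move: st sI; near: s.
  rewrite (near_shift 0 t); apply: filterS => s /= + s0.
  rewrite subr0 /GRing.scale/= mulr1; apply.
  by rewrite -subr_eq0 addrK.
have := cvg_comp _ _ th Vd; apply: cvg_trans; apply: near_eq_cvg; near=> s => /=.
by rewrite addrK /GRing.scale/= mulr1.
Unshelve. all: by end_near. Qed.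

Lemma quotient_on_itv_nincr (V dV : R -> R) :
  (forall t, t \in `[a, b] -> quotient_on `[a, b] V t --> dV t) ->
  (forall t, t \in `[a, b] -> dV t <= 0) ->
  {in `[a, b] &, {homo V : s t /~ s <= t}}.
Proof.
move=> VdV dV0.
have Vder t : t \in `]a, b[ -> is_derive t 1 V (dV t).
  by move=> tab; apply: quotient_on_itv_is_derive => //; apply/VdV/subset_itv_oo_cc.
(* The sign of the derivative is used in the open interval only; the endpoints enter through
   continuity on the closed segment. *)
apply: ler0_derive1_le_cc.
- by move=> t /Vder[].
- by move=> t tab; rewrite derive1E; have [_ ->] := Vder _ tab; apply/dV0/subset_itv_oo_cc.
- apply/subspace_continuousP => t tab.
  move=> P Pt; have := quotient_on_continuous (VdV t tab) Pt.
  rewrite !nbhs_simpl/= /within/= => cP; near=> s => sab.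
  have [->|st] := eqVneq s t; first exact: nbhs_singleton Pt.
  by move: st sab; near: s.
Unshelve. all: by end_near. Qed.

End Interval.

(* Here [a], [b], [e], [p] are the exponentials of nu, alpha, eta, pi; [d1], [d2],
   [d3] the divergences D(xstar, z), D(x, xstar), D(z, x); [k], [l] the inner products
   of grad f(x) with xstar - z and z - x; and [m] stands for f(x) - f(xstar). *)
Lemma lyapunov_rate_le0 (R : realFieldType)
    (a b e p nu' eta' pi' A sigma d1 d2 d3 k l m : R) :
  0 < a -> 0 < b -> 0 < e -> 0 <= d1 -> 0 <= d2 -> 0 <= d3 -> 0 <= m ->
  sigma * d2 <= - m - (k + l) ->
  nu' <= b ->
  - A + (nu' + eta') + p * b <= 0 ->
  A - sigma * (e^-1 * b) - p * b + (nu' + eta' + pi') * p <= 0 ->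
  - A - p * b <= 0 ->
  nu' * a * (e * (d1 + p * d2) + m) +
  a * (eta' * e * (d1 + p * d2) +
       e * (A * (d2 - d1 - d3) + e^-1 * b * k
            + (pi' * p * d2 + p * (b * (d1 - d3 - d2)))) + b * l) <= 0.
Proof.
move=> a0 b0 e0 d1_ge0 d2_ge0 d3_ge0 m_ge0 unif c0 c1 c2 c3.
(* Each of [d1], [d2], [d3], [m] is paired with the left side of one condition. The last term is the
   slack in uniform convexity, whose [sigma * d2] offsets the one put into the coefficient of
   [d2]. *)
rewrite [leLHS](_ : _ = a * (
    e * (d1 * (- A + (nu' + eta') + p * b)
         + d2 * (A - sigma * (e^-1 * b) - p * b + (nu' + eta' + pi') * p)
         + d3 * (- A - p * b))
    + m * (nu' - b) + b * (sigma * d2 - (- m - (k + l))))); last first.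
  by field; rewrite gt_eqF.
rewrite pmulr_rle0//.
apply: ler_wnDl; last by rewrite pmulr_rle0// subr_le0.
apply: ler_wnDl; last by rewrite mulr_ge0_le0// subr_le0.
rewrite pmulr_rle0//; apply: ler_wnDl; last exact: mulr_ge0_le0.
by apply: ler_wnDl; exact: mulr_ge0_le0.
Qed.

(** * The Lyapunov function along a trajectory *)

Theorem theorem4 (R : realType) (n : nat)
  (h f : 'rV[R]_n -> R) (sigma : R) (xstar : 'rV[R]_n)
  (h_diff2 : twice_differentiable h)
  (h_strong : strongly_convex h)
  (h_sym : forall x y, bregman h x y = bregman h y x)
  (f_diff : forall x, differentiable f x)
  (f_convex : convex_function setT f)
  (sigma_ge0 : 0 <= sigma)
  (f_unif : uniformly_convex_wrt sigma h f)
  (xstar_min : forall y, f xstar <= f y)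
  (t0 T : R) (t0_lt_T : t0 < T)
  (I : set R := `[t0, T]%classic)
  (alpha delta eta nu pi : R -> R)
  (alpha_diff : derivable_on I alpha)
  (delta_diff : derivable_on I delta)
  (eta_diff : derivable_on I eta)
  (nu_diff : derivable_on I nu)
  (pi_diff : derivable_on I pi)
  (A : R -> R := fun t =>
     derive_on I delta t + derive_on I eta t - derive_on I alpha t
     - expR (alpha t))
  (cond : forall t, I t ->
     [/\ derive_on I nu t <= expR (alpha t),
         - A t + (derive_on I nu t + derive_on I eta t)
           + expR (pi t + alpha t) <= 0,
         A t - sigma * expR (- eta t + alpha t) - expR (pi t + alpha t)
           + (derive_on I nu t + derive_on I eta t + derive_on I pi t)
             * expR (pi t) <= 0
       & - A t - expR (pi t + alpha t) <= 0])
  (x z : R -> 'rV[R]_n)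
  (x_diff : derivable_on I x)
  (z_diff : derivable_on I z)
  (state : forall t, I t ->
     derive_on I x t = expR (alpha t) *: (z t - x t) /\
     derive_on I z t *m hess h (z t) =
       - A t *: (grad h (z t) - grad h (x t))
       - expR (- eta t + alpha t) *: grad f (x t))
  (V : R -> R := fun t =>
     expR (nu t) * (expR (eta t) *
       (bregman h xstar (z t) + expR (pi t) * bregman h (x t) xstar)
       + (f (x t) - f xstar))) :
  [/\ derivable_on I V,
      (forall t, I t -> derive_on I V t <= 0)
    & (forall s t, I s -> I t -> s <= t -> V t <= V s)].
Proof.
have VdV t : I t -> exists2 dV : R, dV <= 0 & quotient_on I V t --> dV.
  move=> It.
  have [c0 c1 c2 c3] := cond t It; have [xE zE] := state t It.
  have [h_diff grad_h_diff] := h_diff2.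
  have hx : quotient_on I x t --> derive_on I x t := x_diff t It.
  have hz : quotient_on I z t --> derive_on I z t := z_diff t It.
  have heta : quotient_on I eta t --> derive_on I eta t := eta_diff t It.
  have hnu : quotient_on I nu t --> derive_on I nu t := nu_diff t It.
  have hpi : quotient_on I pi t --> derive_on I pi t := pi_diff t It.
  have h1 := quotient_on_bregman_r (y := xstar) (h_diff _) (grad_h_diff _) hz.
  have h2 := quotient_onM (quotient_on_expR hpi)
    (quotient_on_bregman_l (y := xstar) (h_diff _) hx).
  have h3 := quotient_onM (quotient_on_expR heta) (quotient_onD h1 h2).
  have h4 := quotient_onB (quotient_on_grad (f_diff _) hx)
    (quotient_on_cst I (f xstar) t).
  (* The calculus rules determine the derivative; only its sign remains to be shown. *)
  eexists; last exact: quotient_onM (quotient_on_expR hnu) (quotient_onD h3 h4).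
  rewrite subr0 zE xE.
  have -> : dot (grad h (x t) - grad h xstar) (expR (alpha t) *: (z t - x t)) =
      expR (alpha t) * (bregman h xstar (z t) - bregman h (z t) (x t)
                        - bregman h (x t) xstar).
    by rewrite dotZr three_point (h_sym (z t) xstar); ring.
  (* Here the Hessian term has already been replaced through the state equation. *)
  have -> : - dot (- A t *: (grad h (z t) - grad h (x t))
      - expR (- eta t + alpha t) *: grad f (x t)) (xstar - z t) =
      A t * (bregman h (x t) xstar - bregman h xstar (z t) - bregman h (z t) (x t))
      + (expR (eta t))^-1 * expR (alpha t) * dot (grad f (x t)) (xstar - z t).
    rewrite dotDl dotNl !dotZl three_point (h_sym xstar (x t)) expRD expRN; ring.
  rewrite dotZr; rewrite !expRD ?expRN in c1 c2 c3.
  have Dge0 u v := strongly_convex_bregman_ge0 u v h_diff h_strong.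
  apply: (lyapunov_rate_le0 (sigma := sigma)); rewrite ?expR_gt0 ?Dge0 ?subr_ge0//.
  (* Uniform convexity from [x t] to [xstar], with [xstar - x t] split at [z t] to match the two
     pairings [k] and [l]. *)
  have := f_unif (x t) xstar; rewrite (h_sym xstar (x t)) => /le_trans; apply.
  rewrite /bregman !(dotDr, dotNr); lra.
have dVP t : I t -> quotient_on I V t --> derive_on I V t.
  by move=> /VdV[d _ Vd]; apply: (cvgP d).
have dV_le0 t : I t -> derive_on I V t <= 0.
  move=> It; have [d d0 Vd] := VdV t It.
  (* [derive_on] is a [lim], identified with the computed derivative by uniqueness of limits. *)
  have PF : ProperFilter (within I t^') := within_itv_dnbhs_proper t0_lt_T It.
  by rewrite /derive_on (cvg_lim _ Vd).
split=> // s t Is It; exact: (quotient_on_itv_nincr dVP dV_le0).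
Qed.
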